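(* For every instance of the One-Shot Combinatorial Exchange (given by $I$, $n,m$, $\mathcal{A}$, and initial holdings $\mathsf{x}_{i,j}$), the tuple $M_{ce}=(W,\bar w,T,L,U,\pi_\Phi,\pi_Y)$ is an ST-model, and it is a model of the rule set $\Sigma_{ce}$, i.e. $M_{ce}\models\varphi$ for each of the following formulas $\varphi$: 1. $initial \rightarrow bidRound \land \bigwedge_{i\in N}\big(payment_i=0 \land \bigwedge_{j\in G} trade_{i,j}=0\big)$; 2. $terminal\leftrightarrow\neg initial$; 3. $terminal\rightarrow legal_i(noop)$, for each $i\in N$; 4. $initial\rightarrow legal_i(\beta)$, for each $i\in N$, $\beta\in\mathcal{A}$; 5. $does(T_1,\dots,T_n)\land initial\rightarrow \bigcirc\big(\bigwedge_{i\in N}\bigwedge_{j\in G} trade_{i,j}=win_{i,j}(T_1,\dots,T_n,\mathsf{x}_{1,1},\dots,\mathsf{x}_{n,m})\big)$, for each $(T_1,\dots,T_n)\in\mathcal{A}^n$; 6. $does_i(\beta)\land initial\rightarrow\bigcirc\big(payment_i=value_i(\beta,(trade_{i,1},\dots,trade_{i,m}))\big)$, for each $i\in N$, $\beta\in\mathcal{A}$; 7. $terminal\land y=x\rightarrow\bigcirc (y=x)$, for each numerical variable $y\in\{alloc_{i,j},trade_{i,j},payment_i: i\in N,j\in G\}$ and each $x\in I$; 8. $alloc_{i,j}=add(\mathsf{x}_{i,j},trade_{i,j})$, for each $i\in N$, $j\in G$; 9. $\bigcirc\neg bidRound$.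
   Context: **Bid-trees.** $N=\{1,\dots,n\}$ is the set of agents, $G=\{1,\dots,m\}$ the set of goods ($n,m\ge 1$), $I=\{z\in\mathbb{Z}: z_{\min}\le z\le z_{\max}\}$ with $z_{\min}\le 0\le z_{\max}$ and $n,m\in I$; $I_+=I\cap\{0,1,2,\dots\}$. A bid-tree is either a leaf $\langle q,j,v\rangle$ with $q,v\in I$, $j\in G$, or $IC_x^y(\bar\beta,v)$ with $\bar\beta=(\beta_1,\dots,\beta_s)$ a nonempty finite list of bid-trees, $x,y\in I_+$, $v\in I$; the $\beta_k$ are its children. $Node(T)$ is the set of all nodes (occurrences of sub-bids, including the root) of $T$, $Leaf(T)$ the set of leaf nodes, $Child(\beta)$ the children of $\beta$. $v(\beta)$ is the value $v$ written at node $\beta$; $q(\beta,j)=q$ if $\beta=\langle q,j,v\rangle$, and $q(\beta,j)=0$ otherwise; for a non-leaf $\beta=IC_x^y(\cdot)$ put $x_\beta=x$, $y_\beta=y$. For $\lambda\in I^m$, $valid(T,\lambda)$ is the set of $sat:Node(T)\to\{0,1\}$ with $x_\beta\, sat(\beta)\le\sum_{\beta'\in Child(\beta)}sat(\beta')\le y_\beta\, sat(\beta)$ for all non-leaf $\beta$, and $\sum_{\beta\in Leaf(T)}q(\beta,j)sat(\beta)\le\lambda_j$ for all $j\in G$. If $valid(T,\lambda)\neq\emptyset$, the value is $v(T,\lambda)=\max_{sat\in valid(T,\lambda)}\sum_{\beta\in Node(T)}v(\beta)sat(\beta)$. Standing assumption: only bid-trees with all these values in $I$ are considered. Two bid-trees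 are equivalent if they have the same value (or are both undefined) at each $\lambda\in I^m$. $noop=\langle 0,g,0\rangle$ for a fixed $g\in G$. **Winner determination.** For $T=(T_1,\dots,T_n)$ and an allocation $X=(x_{i,j})\in I_+^{nm}$, $WD(T,X)$ maximizes $\sum_{i}\sum_{\beta\in Node(T_i)}v(\beta)sat_i(\beta)$ over $\Lambda=(\lambda_{i,j})\in I^{nm}$ and $sat=(sat_1,\dots,sat_n)$ subject to $\lambda_{i,j}+x_{i,j}\ge0$ for all $i,j$; $\sum_i\lambda_{i,j}=0$ for all $j$; $sat_i\in valid(T_i,\lambda_i)$ for all $i$. $\Lambda(T,X)=(\lambda_{i,j}(T,X))$ is the $\Lambda$-part of an optimal solution, ties broken by a fixed total order on $I^{nm}$. **ST-models and paths.** An ST-model over a finite nonempty action set $\mathcal{A}$ of bid-trees, a set $\Phi$ of atomic propositions and a set $Y$ of numerical variables is $(W,\bar w,T,L,U,\pi_\Phi,\pi_Y)$ with $W$ a nonempty set of states, $\bar w\in W$ initial, $T\subseteq W$ terminal states, $L\subseteq W\times N\times\mathcal{A}$ the legality relation ($L(w,i)=\{a:(w,i,a)\in L\}$), $U:W\times\mathcal{A}^n\to W$, $\pi_\Phi:W\to2^\Phi$, $\pi_Y:W\times Y\to\mathbb{Z}$. A path $\delta$ is an infinite sequence $\bar w=w_0\xrightarrow{d_1}w_1\xrightarrow{d_2}\cdots$ such that for all $t\ge1$: $w_t\ne w_0$; $d_t(i)\in L(w_{t-1},i)$ for all $i\in N$; $w_t=U(w_{t-1},d_t)$; and $w_{t-1}\in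 T$ implies $w_t=w_{t-1}$. Write $\delta[t]=w_t$ and let $\theta_i(\delta,t)=d_{t+1}(i)$ be agent $i$'s action at stage $t$. **Truth** at stage $t\ge0$ of $\delta$: a proposition $p\in\Phi$ holds iff $p\in\pi_\Phi(\delta[t])$; a variable $y$ has value $\pi_Y(\delta[t],y)$; $initial$ iff $\delta[t]=\bar w$; $terminal$ iff $\delta[t]\in T$; $legal_i(\beta)$ iff $\beta\in L(\delta[t],i)$; $does_i(\beta)$ iff $\theta_i(\delta,t)=\beta$; $does(T_1,\dots,T_n)=\bigwedge_i does_i(T_i)$; $\bigcirc\varphi$ iff $\varphi$ holds at $t+1$; Boolean connectives and comparisons are as usual; $add$ is addition; $win_{i,j}(T,X)$ denotes $\lambda_{i,j}(T,X)$; $value_i(\beta,\bar z)$ denotes $v(\beta,\lambda)$, where $\lambda$ is the tuple of current values of $\bar z$. $M\models\varphi$ means $\varphi$ holds at every stage of every path of $M$. **Instance and model $M_{ce}$.** An instance is given by $I,n,m$, initial holdings $\mathsf{x}_{i,j}\in I_+$, and a finite set $\mathcal{A}\ni noop$ of pairwise non-equivalent bid-trees ($I$ being large enough to contain the total supply of goods). $\Phi=\{bidRound\}$ and $Y=\{alloc_{i,j},trade_{i,j},payment_i\}$. $W$ is the set of tuples $\langle b,(x_{i,j}),(\lambda_{i,j}),(p_i)\rangle$ with $b\in\{0,1\}$, $x_{i,j}\in I_+$, $\lambda_{i,j},p_i\in I$; $\bar w=\langle1,(\mathsf{x}_{i,j}),(0),(0)\rangle$; $T=W\setminus\{\bar w\}$;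 $L=\{(w,i,noop):i\in N,w\in T\}\cup\{(\bar w,i,\beta):i\in N,\beta\in\mathcal{A}\}$; $U(\bar w,d)=\langle0,(x'_{i,j}),(\lambda'_{i,j}),(p'_i)\rangle$ with $\lambda'_{i,j}=\lambda_{i,j}(d,(\mathsf{x}_{i,j}))$, $x'_{i,j}=\mathsf{x}_{i,j}+\lambda'_{i,j}$, $p'_i=v(d(i),(\lambda'_{i,1},\dots,\lambda'_{i,m}))$; $U(w,d)=w$ for $w\ne\bar w$. In a state $w=\langle b,(x_{i,j}),(\lambda_{i,j}),(p_i)\rangle$: $trade_{i,j}$ has value $\lambda_{i,j}$, $alloc_{i,j}$ has value $x_{i,j}$, $payment_i$ has value $p_i$, and $bidRound$ holds iff $b=1$. *)

(* Defs.v *)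
(* MathComp, with the classical sets and classical choice of MathComp-Analysis. *)
From HB Require Import structures.
From mathcomp Require Import all_boot all_order all_algebra.
From mathcomp Require Import boolp classical_sets cardinality.

Set Implicit Arguments.
Unset Strict Implicit.
Unset Printing Implicit Defensive.

Import Order.TTheory GRing.Theory Num.Theory.
Local Open Scope ring_scope.

(* Agents are 'I_n and goods are 'I_m.  The finite range I is the integer
   interval [zmin, zmax].  Quantities are plain integers and membership in I
   is always stated separately, so that "U maps W x A^n into W" below is a
   genuine claim rather than a typing fact. *)

Definition in_I (zmin zmax z : int) : bool := zmin <= z <= zmax.

Definition in_Iplus (zmin zmax z : int) : bool := in_I zmin zmax z && (0 <= z).

Definition in_Imx (zmin zmax : int) (k l : nat) (L : 'M[int]_(k, l)) : bool :=
  [forall i, forall j, in_I zmin zmax (L i j)].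

(* [Leaf q j v] is <q, j, v>, and [IC x y bs v] is IC_x^y(bs, v). *)
Inductive bidtree (m : nat) : Type :=
| Leaf of int & 'I_m & int
| IC of int & int & seq (bidtree m) & int.

Arguments Leaf {m}.
Arguments IC {m}.

Section BidTrees.

Variable m : nat.
Implicit Types (T b : bidtree m) (lam : 'rV[int]_m).

Fixpoint bidtree_over (zmin zmax : int) T : bool :=
  match T with
  | Leaf q _ v => in_I zmin zmax q && in_I zmin zmax v
  | IC x y bs v =>
      [&& (0 < size bs)%N, in_Iplus zmin zmax x, in_Iplus zmin zmax y,
          in_I zmin zmax v & all (bidtree_over zmin zmax) bs]
  end.

(* A node is an occurrence of a sub-bid, encoded by its address: the list of
   child indices leading to it from the root, whose address is [::]. *)
Fixpoint addresses T : seq (seq nat) :=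
  match T with
  | Leaf _ _ _ => [:: [::]]
  | IC _ _ bs _ =>
      [::] :: [seq k :: p | k <- iota 0 (size bs),
                            p <- nth [::] (map addresses bs) k]
  end.

Definition node T : finType := seq_sub (addresses T).

(* The default values are never used on an address of [T]. *)
Fixpoint sub_bid T (p : seq nat) : bidtree m :=
  match p, T with
  | k :: p', IC _ _ bs _ => sub_bid (nth T bs k) p'
  | _, _ => T
  end.

Definition bid_at T (p : node T) : bidtree m := sub_bid T (ssval p).

Definition is_child T (p q : node T) : bool :=
  ssval q == rcons (ssval p) (last 0%N (ssval q)).

Definition is_leaf b : bool := if b is Leaf _ _ _ then true else false.

Definition bid_val b : int :=
  match b with Leaf _ _ v => v | IC _ _ _ v => v end.

Definition bid_qty b (j : 'I_m) : int :=
  match b with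
  | Leaf q k _ => if k == j then q else 0
  | IC _ _ _ _ => 0
  end.

Definition valid T lam (sat : {ffun node T -> bool}) : bool :=
  [forall p, match bid_at p with
             | Leaf _ _ _ => true
             | IC x y _ _ =>
                 x * (sat p)%:Z <= \sum_(q | is_child p q) (sat q)%:Z
                   <= y * (sat p)%:Z
             end]
  && [forall j, \sum_(p | is_leaf (bid_at p)) bid_qty (bid_at p) j * (sat p)%:Z
                  <= lam 0 j].

Definition worth T (sat : {ffun node T -> bool}) : int :=
  \sum_p bid_val (bid_at p) * (sat p)%:Z.

(* v(T, lam), which is [None] when valid(T, lam) is empty. *)
Definition tree_value T lam : option int :=
  omap (fun s0 => worth [arg max_(s > s0 | valid lam s) worth s]%O)
       [pick s : {ffun node T -> bool} | valid lam s].

Definition bid_equiv (zmin zmax : int) T T' : Prop :=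
  forall lam, in_Imx zmin zmax lam -> tree_value T lam = tree_value T' lam.

End BidTrees.

Section WinnerDetermination.

Variables (n m : nat) (zmin zmax : int) (tie : rel 'M[int]_(n, m)).
Implicit Types (T : 'I_n -> bidtree m) (X L : 'M[int]_(n, m)).

Definition wd_feasible T X L (sat : forall i, {ffun node (T i) -> bool}) : Prop :=
  [/\ in_Imx zmin zmax L,
      forall i j, 0 <= L i j + X i j,
      forall j, \sum_i L i j = 0
    & forall i, valid (row i L) (sat i)].

Definition wd_objective T (sat : forall i, {ffun node (T i) -> bool}) : int :=
  \sum_i worth (sat i).

Definition wd_optimal T X L (sat : forall i, {ffun node (T i) -> bool}) : Prop :=
  wd_feasible X L sat /\
  forall L' sat', @wd_feasible T X L' sat' ->
    wd_objective sat' <= wd_objective sat.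

Definition wd_trades T X : set 'M[int]_(n, m) :=
  [set L | exists sat, @wd_optimal T X L sat]%classic.

(* Lambda(T, X): the [tie]-least trade matrix among the optimal solutions (the
   default 0 is returned only if there is none). *)
Definition win_trade T X : 'M[int]_(n, m) :=
  xget 0 [set L | wd_trades T X L /\
                  forall L', wd_trades T X L' -> tie L L']%classic.

End WinnerDetermination.

(* The raw data (W, w0, T, L, U, pi_Phi, pi_Y), on an ambient type [S] of which
   W is a subset. *)
Record st_data (n m : nat) (S Phi Y : Type) : Type := STData {
  st_states : set S;
  st_init : S;
  st_terminal : set S;
  st_legal : set (S * 'I_n * bidtree m);
  st_update : S -> ('I_n -> bidtree m) -> S;
  st_props : S -> set Phi;
  st_vars : S -> Y -> int
}.

Definition is_st_model (n m : nat) (S Phi Y : Type) (A : set (bidtree m))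
    (M : st_data n m S Phi Y) : Prop :=
  finite_set A /\ (A !=set0)%classic /\
  (st_states M !=set0)%classic /\
  st_states M (st_init M) /\
  (forall w, st_terminal M w -> st_states M w) /\
  (forall w i b, st_legal M (w, i, b) -> st_states M w /\ A b) /\
  (forall w d, st_states M w -> (forall i, A (d i)) ->
     st_states M (st_update M w d)).

(* [path_state t] is w_t, and [path_act t] is the joint action d_(t+1) taken at
   stage t.  In an ST-model the conditions of [is_path] force every w_t to lie in
   W and every action to lie in A. *)
Record st_path (n m : nat) (S : Type) : Type := STPath {
  path_state : nat -> S;
  path_act : nat -> 'I_n -> bidtree m
}.

Definition is_path (n m : nat) (S Phi Y : Type) (M : st_data n m S Phi Y)
    (delta : st_path n m S) : Prop :=
  path_state delta 0 = st_init M /\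
  forall t,
    [/\ path_state delta t.+1 <> path_state delta 0,
        forall i, st_legal M (path_state delta t, i, path_act delta t i),
        path_state delta t.+1
          = st_update M (path_state delta t) (path_act delta t)
      & st_terminal M (path_state delta t) ->
        path_state delta t.+1 = path_state delta t].

Inductive term (n m : nat) (Y : Type) : Type :=
| TVar of Y
| TConst of int
| TAdd of term n m Y & term n m Y
| TWin of 'I_n & 'I_m & ('I_n -> bidtree m) & 'M[int]_(n, m)
| TValue of 'I_n & bidtree m & ('I_m -> term n m Y).

Arguments TVar {n m Y}.
Arguments TConst {n m Y}.
Arguments TAdd {n m Y}.
Arguments TWin {n m Y}.
Arguments TValue {n m Y}.

Inductive formula (n m : nat) (Phi Y : Type) : Type :=
| FProp of Phi
| FInitial
| FTerminal
| FLegal of 'I_n & bidtree m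
| FDoes of 'I_n & bidtree m
| FEq of term n m Y & term n m Y
| FLt of term n m Y & term n m Y
| FTrue
| FNot of formula n m Phi Y
| FAnd of formula n m Phi Y & formula n m Phi Y
| FImp of formula n m Phi Y & formula n m Phi Y
| FNext of formula n m Phi Y.

Arguments FProp {n m Phi Y}.
Arguments FInitial {n m Phi Y}.
Arguments FTerminal {n m Phi Y}.
Arguments FLegal {n m Phi Y}.
Arguments FDoes {n m Phi Y}.
Arguments FEq {n m Phi Y}.
Arguments FLt {n m Phi Y}.
Arguments FTrue {n m Phi Y}.

Definition FIff (n m : nat) (Phi Y : Type) (f g : formula n m Phi Y) :=
  FAnd (FImp f g) (FImp g f).

Definition FDoesAll (n m : nat) (Phi Y : Type) (T : 'I_n -> bidtree m) :
    formula n m Phi Y :=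
  \big[@FAnd n m Phi Y/FTrue]_(i < n) FDoes i (T i).

Section Semantics.

Variables (n m : nat) (zmin zmax : int) (tie : rel 'M[int]_(n, m)).
Variables (S Phi Y : Type) (M : st_data n m S Phi Y).

(* [denotes w e z]: the term [e] is defined in state [w] and has value [z].
   Terms are partial because v(beta, lam) may be undefined; a comparison holds
   only if both of its sides are defined. *)
Fixpoint denotes (w : S) (e : term n m Y) (z : int) : Prop :=
  match e with
  | TVar y => z = st_vars M w y
  | TConst c => z = c
  | TAdd e1 e2 =>
      exists z1 z2, [/\ denotes w e1 z1, denotes w e2 z2 & z = z1 + z2]
  | TWin i j T X => z = win_trade zmin zmax tie T X i j
  | TValue _ b es =>
      exists lam : 'rV[int]_m,
        [/\ forall j, denotes w (es j) (lam 0 j),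
            in_Imx zmin zmax lam
          & tree_value b lam = Some z]
  end.

Fixpoint holds (delta : st_path n m S) (t : nat) (f : formula n m Phi Y) : Prop :=
  match f with
  | FProp p => st_props M (path_state delta t) p
  | FInitial => path_state delta t = st_init M
  | FTerminal => st_terminal M (path_state delta t)
  | FLegal i b => st_legal M (path_state delta t, i, b)
  | FDoes i b => path_act delta t i = b
  | FEq e1 e2 =>
      exists z1 z2, [/\ denotes (path_state delta t) e1 z1,
                        denotes (path_state delta t) e2 z2 & z1 = z2]
  | FLt e1 e2 =>
      exists z1 z2, [/\ denotes (path_state delta t) e1 z1,
                        denotes (path_state delta t) e2 z2 & z1 < z2]
  | FTrue => True
  | FNot g => ~ holds delta t g
  | FAnd g h => holds delta t g /\ holds delta t h
  | FImp g h => holds delta t g -> holds delta t h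
  | FNext g => holds delta t.+1 g
  end.

Definition models (f : formula n m Phi Y) : Prop :=
  forall delta, is_path M delta -> forall t, holds delta t f.

End Semantics.

(* [ce_tie] is the fixed tie-breaking total order on I^(n m), and [ce_good] the
   good g in noop = <0, g, 0>.  [ce_actions_value] is the standing assumption
   that the values of the bids considered lie in I wherever they are defined. *)
Record ce_instance (n m : nat) : Type := CEInstance {
  ce_zmin : int;
  ce_zmax : int;
  ce_tie : rel 'M[int]_(n, m);
  ce_good : 'I_m;
  ce_hold : 'M[int]_(n, m);
  ce_actions : set (bidtree m);
  ce_n_gt0 : (0 < n)%N;
  ce_m_gt0 : (0 < m)%N;
  ce_zmin_le0 : ce_zmin <= 0;
  ce_zmax_ge0 : 0 <= ce_zmax;
  ce_n_in : in_I ce_zmin ce_zmax n%:Z;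
  ce_m_in : in_I ce_zmin ce_zmax m%:Z;
  ce_tie_total :
    forall L L', in_Imx ce_zmin ce_zmax L -> in_Imx ce_zmin ce_zmax L' ->
    ce_tie L L' || ce_tie L' L;
  ce_tie_anti :
    forall L L', in_Imx ce_zmin ce_zmax L -> in_Imx ce_zmin ce_zmax L' ->
    ce_tie L L' -> ce_tie L' L -> L = L';
  ce_tie_trans :
    forall L L' L'', in_Imx ce_zmin ce_zmax L -> in_Imx ce_zmin ce_zmax L' ->
    in_Imx ce_zmin ce_zmax L'' -> ce_tie L L' -> ce_tie L' L'' -> ce_tie L L'';
  ce_hold_in : forall i j, in_Iplus ce_zmin ce_zmax (ce_hold i j);
  ce_supply_in : forall j, in_I ce_zmin ce_zmax (\sum_i ce_hold i j);
  ce_actions_finite : finite_set ce_actions;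
  ce_actions_noop : ce_actions (Leaf 0 ce_good 0);
  ce_actions_over : forall b, ce_actions b -> bidtree_over ce_zmin ce_zmax b;
  ce_actions_value :
    forall b, ce_actions b -> forall lam, in_Imx ce_zmin ce_zmax lam ->
    forall z, tree_value b lam = Some z -> in_I ce_zmin ce_zmax z;
  ce_actions_inequiv :
    forall b b', ce_actions b -> ce_actions b' -> b <> b' ->
    ~ bid_equiv ce_zmin ce_zmax b b'
}.

Inductive ce_prop : Type := BidRound.

Inductive ce_var (n m : nat) : Type :=
| Alloc of 'I_n & 'I_m
| Trade of 'I_n & 'I_m
| Payment of 'I_n.

Arguments Alloc {n m}.
Arguments Trade {n m}.
Arguments Payment {n m}.

Record ce_state (n m : nat) : Type := CEState {
  round : bool;
  alloc : 'M[int]_(n, m);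
  trade : 'M[int]_(n, m);
  payment : 'rV[int]_n
}.

Section CombinatorialExchange.

Variables (n m : nat) (E : ce_instance n m).

Let zmin := ce_zmin E.
Let zmax := ce_zmax E.

Definition ce_noop : bidtree m := Leaf 0 (ce_good E) 0.

Definition ce_W : set (ce_state n m) :=
  [set w | [/\ forall i j, in_Iplus zmin zmax (alloc w i j),
               in_Imx zmin zmax (trade w)
             & in_Imx zmin zmax (payment w)]]%classic.

Definition ce_init : ce_state n m := CEState true (ce_hold E) 0 0.

Definition ce_T : set (ce_state n m) :=
  [set w | ce_W w /\ w <> ce_init]%classic.

Definition ce_L : set (ce_state n m * 'I_n * bidtree m) :=
  [set u | (ce_T u.1.1 /\ u.2 = ce_noop)
        \/ (u.1.1 = ce_init /\ ce_actions E u.2)]%classic.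

(* For bids in A the value of an agent's own winning trade is always defined,
   so the default 0 of [odflt] is irrelevant. *)
Definition ce_U (w : ce_state n m) (d : 'I_n -> bidtree m) : ce_state n m :=
  if `[< w = ce_init >] then
    let L := win_trade zmin zmax (@ce_tie _ _ E) d (ce_hold E) in
    CEState false (ce_hold E + L) L
            (\row_i odflt 0 (tree_value (d i) (row i L)))
  else w.

Definition ce_props (w : ce_state n m) : set ce_prop :=
  [set p | match p with BidRound => round w = true end]%classic.

Definition ce_vars (w : ce_state n m) (y : ce_var n m) : int :=
  match y with
  | Alloc i j => alloc w i j
  | Trade i j => trade w i j
  | Payment i => payment w 0 i
  end.

Definition M_ce : st_data n m (ce_state n m) ce_prop (ce_var n m) :=
  STData ce_W ce_init ce_T ce_L ce_U ce_props ce_vars.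

Local Notation form := (formula n m ce_prop (ce_var n m)).
Local Notation And := (@FAnd n m ce_prop (ce_var n m)).

Inductive Sigma_ce : form -> Prop :=
| ce_rule1 :
    Sigma_ce (FImp FInitial
      (FAnd (FProp BidRound)
         (\big[And/FTrue]_(i < n)
            FAnd (FEq (TVar (Payment i)) (TConst 0))
                 (\big[And/FTrue]_(j < m)
                    FEq (TVar (Trade i j)) (TConst 0)))))
| ce_rule2 :
    Sigma_ce (FIff FTerminal (FNot FInitial))
| ce_rule3 i :
    Sigma_ce (FImp FTerminal (FLegal i ce_noop))
| ce_rule4 i b : ce_actions E b ->
    Sigma_ce (FImp FInitial (FLegal i b))
| ce_rule5 (T : 'I_n -> bidtree m) : (forall i, ce_actions E (T i)) ->
    Sigma_ce (FImp (FAnd (FDoesAll _ _ T) FInitial)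
      (FNext (\big[And/FTrue]_(i < n) \big[And/FTrue]_(j < m)
                FEq (TVar (Trade i j)) (TWin i j T (ce_hold E)))))
| ce_rule6 i b : ce_actions E b ->
    Sigma_ce (FImp (FAnd (FDoes i b) FInitial)
      (FNext (FEq (TVar (Payment i))
                  (TValue i b (fun j => TVar (Trade i j))))))
| ce_rule7 (y : ce_var n m) (x : int) : in_I zmin zmax x ->
    Sigma_ce (FImp (FAnd FTerminal (FEq (TVar y) (TConst x)))
      (FNext (FEq (TVar y) (TConst x))))
| ce_rule8 i j :
    Sigma_ce (FEq (TVar (Alloc i j))
                  (TAdd (TConst (ce_hold E i j)) (TVar (Trade i j))))
| ce_rule9 :
    Sigma_ce (FNext (FNot (FProp BidRound))).

Definition ce_models (f : form) : Prop :=
  models zmin zmax (@ce_tie _ _ E) M_ce f.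

End CombinatorialExchange.

(* Main.v *)
(* Winner determination is always feasible: trade nothing and satisfy no node.
   Only finitely many trade matrices have entries in I, so an optimum exists and
   the tie-breaking order selects one; this makes the update well defined and
   every payment a genuine bid value.  The initial state has bidRound true, so an
   update never leads back to it, and a path is constant from stage 1 on: each
   rule needs checking only at the initial state and at its unique successor. *)
Require Import Defs.
From mathcomp Require Import all_boot all_order all_algebra.
From mathcomp Require Import boolp classical_sets.
From mathcomp Require Import zify.

Set Implicit Arguments.
Unset Strict Implicit.
Unset Printing Implicit Defensive.

Import Order.TTheory GRing.Theory Num.Theory.
Local Open Scope ring_scope.

(** * Matrices over the range and the empty assignment *)

Lemma in_ImxP (zmin zmax : int) (k l : nat) (L : 'M[int]_(k, l)) :
  reflect (forall i j, in_I zmin zmax (L i j)) (in_Imx zmin zmax L).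
Proof.
apply: (iffP forallP) => [h i j|h i]; first exact: (forallP (h i)).
by apply/forallP.
Qed.

Lemma row_in_Imx (zmin zmax : int) (k l : nat) (L : 'M[int]_(k, l)) i :
  in_Imx zmin zmax L -> in_Imx zmin zmax (row i L).
Proof. by move=> /in_ImxP h; apply/in_ImxP => a j; rewrite mxE. Qed.

(* Parametrizes the matrices with entries in [zmin, zmax] by a finite type. *)
Definition decode (zmin zmax : int) (k l : nat)
    (c : 'M['I_(absz (zmax - zmin)).+1]_(k, l)) : 'M[int]_(k, l) :=
  map_mx (fun a : 'I_(absz (zmax - zmin)).+1 => zmin + (a : nat)%:Z) c.

Lemma decode_in_Imx (zmin zmax : int) (k l : nat)
    (c : 'M['I_(absz (zmax - zmin)).+1]_(k, l)) :
  zmin <= zmax -> in_Imx zmin zmax (decode c).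
Proof.
move=> zle; apply/in_ImxP => i j; rewrite mxE /in_I.
by have := ltn_ord (c i j); lia.
Qed.

Lemma in_Imx_decode (zmin zmax : int) (k l : nat) (L : 'M[int]_(k, l)) :
  in_Imx zmin zmax L ->
  exists c : 'M['I_(absz (zmax - zmin)).+1]_(k, l), decode c = L.
Proof.
move=> /in_ImxP LI; exists (\matrix_(i, j) inord (absz (L i j - zmin))).
apply/matrixP => i j; rewrite !mxE; have := LI i j; rewrite /in_I => h.
by rewrite inordK; lia.
Qed.

(** With no node satisfied every sum vanishes, so each constraint reads [0 <= 0]. *)
Lemma valid0 (m : nat) (T : bidtree m) :
  valid (T := T) 0 [ffun=> false].
Proof.
apply/andP; split; apply/forallP => i.
  case: bid_at => // x y _ _.
  by rewrite ffunE !mulr0 big1 ?lexx // => q _; rewrite ffunE.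
by rewrite big1 ?mxE // => p _; rewrite ffunE mulr0.
Qed.

Lemma valid_tree_value (m : nat) (T : bidtree m) lam (s : {ffun node T -> bool}) :
  valid lam s -> exists z, tree_value T lam = Some z.
Proof.
rewrite /tree_value => vs; case: pickP => [s0 _|none]; first by eexists.
by have := none s; rewrite vs.
Qed.

(** * Existence of an optimal trade and its selection by tie-breaking *)

Section WinnerDetermination.

Variables (n m : nat) (zmin zmax : int) (tie : rel 'M[int]_(n, m)).
Variables (T : 'I_n -> bidtree m) (X : 'M[int]_(n, m)).
Hypotheses (zmin_le0 : zmin <= 0) (zmax_ge0 : 0 <= zmax).
Hypothesis X_ge0 : forall i j, 0 <= X i j.
Hypothesis tie_total :
  forall L L', in_Imx zmin zmax L -> in_Imx zmin zmax L' -> tie L L' || tie L' L.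
Hypothesis tie_trans :
  forall L L' L'', in_Imx zmin zmax L -> in_Imx zmin zmax L' ->
  in_Imx zmin zmax L'' -> tie L L' -> tie L' L'' -> tie L L''.

Let zle : zmin <= zmax := le_trans zmin_le0 zmax_ge0.
Let code := 'M['I_(absz (zmax - zmin)).+1]_(n, m).

Lemma wd_feasible0 :
  wd_feasible zmin zmax X 0 (fun i => [ffun=> false] : {ffun node (T i) -> bool}).
Proof.
split=> [|i j|j|i].
- by apply/in_ImxP => i j; rewrite mxE /in_I zmin_le0.
- by rewrite mxE add0r.
- by rewrite big1 // => i _; rewrite mxE.
- by rewrite row0; exact: valid0.
Qed.

Lemma wd_optimal_exists : exists L sat, @wd_optimal n m zmin zmax T X L sat.
Proof.
pose sats := {dffun forall i, {ffun node (T i) -> bool}}.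
pose feas (p : code * sats) : bool := `[< wd_feasible zmin zmax X (decode p.1) p.2 >].
pose obj (p : code * sats) := wd_objective p.2.
(* Feasibility speaks of plain dependent functions, while the finite type [sats] consists of finite
   functions; extensionality identifies the two. *)
have finE (sat : forall i, {ffun node (T i) -> bool}) :
    (finfun sat : sats) = sat :> (forall i, _).
  by apply: functional_extensionality_dep => i; rewrite ffunE.
have codeP L (sat : forall i, {ffun node (T i) -> bool}) :
    wd_feasible zmin zmax X L sat -> exists2 p, feas p & obj p = wd_objective sat.
  move=> fL; have [c cL] := in_Imx_decode (let: And4 LI _ _ _ := fL in LI).
  exists (c, finfun sat); first by apply/asboolP; rewrite /= cL finE.
  by rewrite /obj /= finE.
have [p0 fp0 _] := codeP _ _ wd_feasible0.
case: (@arg_maxP _ _ _ p0 feas obj fp0) => p /asboolP fp pmax.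
exists (decode p.1), p.2; split=> // L' sat' /codeP[q fq <-].
exact: pmax.
Qed.

Lemma wd_trades_in_Imx L : wd_trades zmin zmax T X L -> in_Imx zmin zmax L.
Proof. by case=> sat [[]]. Qed.

(** The relation [tie] is assumed total and transitive on bounded matrices only, so it is pulled
    back along [decode] to codes, where both properties hold outright. A least optimal code then
    excludes the default of [xget]. *)
Lemma win_trade_optimal : wd_trades zmin zmax T X (win_trade zmin zmax tie T X).
Proof.
suff [L LP] : exists L, wd_trades zmin zmax T X L /\
    forall L', wd_trades zmin zmax T X L' -> tie L L'.
  rewrite /win_trade; case: xgetP => [L' _ []//|none].
  by have := none L LP.
have [L0 [sat0 opt0]] := wd_optimal_exists.
have tr0 : wd_trades zmin zmax T X L0 by exists sat0.
have [c0 c0E] := in_Imx_decode (wd_trades_in_Imx tr0).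
pose P (c : code) : bool := `[< wd_trades zmin zmax T X (decode c) >].
pose ord (c c' : code) := tie (decode c) (decode c').
have ord_total : total ord by move=> c c'; apply: tie_total; exact: decode_in_Imx.
have ord_refl : reflexive ord by move=> c; have := ord_total c c; rewrite orbb.
have ord_trans : transitive ord.
  by move=> c c' c''; apply: tie_trans; exact: decode_in_Imx.
have P0 : P c0 by apply/asboolP; rewrite c0E.
case: (extremumP id ord_refl ord_trans ord_total P0) => c /asboolP Pc cmin.
exists (decode c); split=> // L' tr'.
have [c' c'E] := in_Imx_decode (wd_trades_in_Imx tr'); rewrite -c'E.
by apply: cmin; apply/asboolP; rewrite c'E.
Qed.

End WinnerDetermination.

(** [FAnd] is a bare constructor without monoid laws, so the iterated conjunction is unfolded by
    induction on the list of indices. *)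
Lemma holds_bigAnd (n m : nat) (zmin zmax : int) (tie : rel 'M[int]_(n, m))
    (S Phi Y : Type) (M : st_data n m S Phi Y) delta t (k : nat)
    (F : 'I_k -> formula n m Phi Y) :
  holds zmin zmax tie M delta t
    (\big[@FAnd n m Phi Y/@FTrue n m Phi Y]_(i < k) F i) <->
  forall i, holds zmin zmax tie M delta t (F i).
Proof.
suff H (r : seq 'I_k) : holds zmin zmax tie M delta t
      (\big[@FAnd n m Phi Y/@FTrue n m Phi Y]_(i <- r) F i) <->
    forall i, i \in r -> holds zmin zmax tie M delta t (F i).
  rewrite H; split=> h i; last by move=> _; exact: h.
  by apply: h; rewrite mem_index_enum.
elim: r => [|a r IH]; first by rewrite big_nil.
rewrite big_cons /= IH; split=> [[ha hr] i|h].
  by rewrite inE => /predU1P[->|/hr].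
split=> [|i ir]; apply: h; first exact: mem_head.
by rewrite inE ir orbT.
Qed.

(** * The exchange as an ST-model *)

Section Exchange.

Variables (n m : nat) (E : ce_instance n m).

Let zmin := ce_zmin E.
Let zmax := ce_zmax E.
Let winner (d : 'I_n -> bidtree m) := win_trade zmin zmax (@ce_tie _ _ E) d (ce_hold E).

(** The assignments that witness feasibility of the selected trade also show that each agent's bid
    has a value on that agent's row. *)
Lemma ce_winnerP d :
  [/\ in_Imx zmin zmax (winner d), forall i j, 0 <= winner d i j + ce_hold E i j,
      forall j, \sum_i winner d i j = 0
    & forall i, exists z, tree_value (d i) (row i (winner d)) = Some z].
Proof.
have X_ge0 i j : 0 <= ce_hold E i j by have /andP[] := ce_hold_in E i j.
have [sat [[LI Lge0 Lsum vsat] _]] := win_trade_optimal d (ce_zmin_le0 E)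
  (ce_zmax_ge0 E) X_ge0 (@ce_tie_total _ _ E) (@ce_tie_trans _ _ E).
split=> // i; exact: valid_tree_value (vsat i).
Qed.

Lemma ce_init_in_W : ce_W E (ce_init E).
Proof.
split=> [i j||]; first exact: ce_hold_in.
  by apply/in_ImxP => i j; rewrite mxE /in_I ce_zmin_le0 ce_zmax_ge0.
by apply/in_ImxP => i j; rewrite mxE /in_I ce_zmin_le0 ce_zmax_ge0.
Qed.

Lemma ce_U_init d : ce_U E (ce_init E) d =
  CEState false (ce_hold E + winner d) (winner d)
    (\row_i odflt 0 (tree_value (d i) (row i (winner d)))).
Proof. by rewrite /ce_U asboolT. Qed.

Lemma ce_U_id w d : w <> ce_init E -> ce_U E w d = w.
Proof. by move=> h; rewrite /ce_U asboolF. Qed.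

(** The bids must be actions for the payment bound: only values of actions are assumed to lie in the
    range. *)
Lemma ce_U_init_in_W d : (forall i, ce_actions E (d i)) ->
  ce_W E (ce_U E (ce_init E) d).
Proof.
move=> dA; rewrite ce_U_init.
have [LI Lge0 Lsum vL] := ce_winnerP d.
split=> [i j||] //=; last first.
  apply/in_ImxP => i j; rewrite mxE; have [z zE] := vL j; rewrite zE /=.
  by apply: ce_actions_value (dA j) _ _ _ zE; exact: row_in_Imx.
rewrite mxE addrC /in_Iplus Lge0 andbT /in_I (le_trans (ce_zmin_le0 E)) //=.
(* Trades of a good sum to zero, so no agent ends up with more than its supply. *)
have /andP[_] := ce_supply_in E j; apply: le_trans.
have -> : \sum_k ce_hold E k j = \sum_k (winner d k j + ce_hold E k j).
  by rewrite big_split /= Lsum add0r.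
rewrite (bigD1 i) //= lerDl.
by apply: sumr_ge0 => k _; exact: Lge0.
Qed.

Lemma M_ce_is_st_model : is_st_model (ce_actions E) (M_ce E).
Proof.
split; first exact: ce_actions_finite.
split; first by exists (ce_noop E); exact: ce_actions_noop.
split; first by exists (ce_init E); exact: ce_init_in_W.
split; first exact: ce_init_in_W.
split; first by move=> w [].
split.
  move=> w i b [[[wW _] /= ->]|[/= -> bA]]; split=> //.
    exact: ce_actions_noop.
  exact: ce_init_in_W.
move=> w d wW dA /=; have [->|wi] := pselect (w = ce_init E).
  exact: ce_U_init_in_W.
by rewrite ce_U_id.
Qed.

(** * Paths of the exchange *)

Section Path.

Variable delta : st_path n m (ce_state n m).
Hypothesis pathP : is_path (M_ce E) delta.

Lemma path_state0 : path_state delta 0 = ce_init E.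
Proof. by case: pathP. Qed.

Lemma path_stateS_neq t : path_state delta t.+1 <> ce_init E.
Proof. by rewrite -path_state0; case: pathP => _ /(_ t) []. Qed.

(** The first step updates the initial state; no later state is initial, and the update fixes every
    such state. *)
Lemma path_stateS t :
  path_state delta t.+1 = ce_U E (ce_init E) (path_act delta 0).
Proof.
elim: t => [|t IH].
  by case: pathP => s0 /(_ 0%N)[_ _ -> _]; rewrite s0.
case: pathP => _ /(_ t.+1)[_ _ -> _] /=.
by rewrite ce_U_id //; exact: path_stateS_neq.
Qed.

Lemma path_act0 i : ce_actions E (path_act delta 0 i).
Proof.
case: pathP => _ /(_ 0%N)[_ /(_ i) + _ _]; rewrite path_state0.
(* Legality through the [noop] clause would make the initial state terminal. *)
by case=> [[[_ +] _]|[]].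
Qed.

Lemma path_stateS_terminal t : ce_T E (path_state delta t.+1).
Proof.
split; last exact: path_stateS_neq.
rewrite path_stateS; apply: ce_U_init_in_W; exact: path_act0.
Qed.

Lemma path_initial t : path_state delta t = ce_init E -> t = 0%N.
Proof. by case: t => // t /path_stateS_neq. Qed.

End Path.

(** * Verification of the nine rules *)

Lemma M_ce_models_Sigma_ce f : Sigma_ce E f -> ce_models E f.
Proof.
move=> fS delta dP t.
case: fS => [||i|i b bA|d dA|i b bA|y x _|i j|] /=.
- move=> s0; split; first by rewrite s0.
  apply/holds_bigAnd => i /=; split; first by exists 0, 0; rewrite s0 /= mxE.
  by apply/holds_bigAnd => j /=; exists 0, 0; rewrite s0 /= mxE.
- split=> [[]//|]; case: t => [|t _]; first by rewrite path_state0.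
  exact: path_stateS_terminal.
- by left.
- by right.
- move=> [/holds_bigAnd dE /(path_initial dP) t0]; subst t.
  (* The winning trade depends on the whole joint action, so agreement agent by agent is turned into
     an equality of functions. *)
  have {}dE : path_act delta 0 = d by apply: funext => i; exact: dE.
  apply/holds_bigAnd => i; apply/holds_bigAnd => j /=.
  by rewrite path_stateS // ce_U_init /= dE; eexists; eexists.
- move=> [dE /(path_initial dP) t0]; subst t.
  rewrite path_stateS // ce_U_init /=; set d := path_act delta 0.
  have [LI _ _ /(_ i)[z zE]] := ce_winnerP d.
  exists z, z; split=> //; first by rewrite mxE zE.
  (* The value term reads the trades of the new state, whose row [i] is the one the payment was
     computed from. *)
  exists (row i (winner d)); split; last by rewrite -dE.
    by move=> j; rewrite mxE.
  exact: row_in_Imx.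
(* The initial state is not terminal, so the stage is positive, and all positive stages share one
   state. *)
- case: t => [[[_]]|t [_]]; first by rewrite path_state0.
  by rewrite !path_stateS.
(* Initially all trades are zero; afterwards the update has added the trades to the initial
   holdings. *)
- case: t => [|t].
    rewrite path_state0 //=; exists (ce_hold E i j), (ce_hold E i j); split=> //.
    by exists (ce_hold E i j), 0; rewrite mxE addr0.
  rewrite path_stateS // ce_U_init /=; set L := winner _.
  exists ((ce_hold E + L) i j), ((ce_hold E + L) i j); split=> //.
  by exists (ce_hold E i j), (L i j); rewrite mxE.
- by rewrite path_stateS // ce_U_init.
Qed.

End Exchange.

Theorem proposition3 (n m : nat) (E : ce_instance n m) :
  is_st_model (ce_actions E) (M_ce E) /\
  (forall f : formula n m ce_prop (ce_var n m), Sigma_ce E f -> ce_models E f).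
Proof. by split; [exact: M_ce_is_st_model|exact: M_ce_models_Sigma_ce]. Qed.
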